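(* Let $\mu>0$. Let $n\ge1$ be an integer, let $X_1,\dots,X_n$ be i.i.d. geometric random variables (failure model) with mean $\mu$, and let $\bar X_n=(X_1+\cdots+X_n)/n$. For $\lambda>0$ define $$H(\lambda,\mu):=\mu\lambda\ln\lambda-(1+\mu\lambda)\ln\left(\frac{1+\mu\lambda}{1+\mu}\right),$$ $$\Delta_U(\lambda,\mu):=\frac76+\ln\left(\lambda+\frac{2}{\mu}\right),\qquad \Delta_L(\lambda,\mu):=\frac16+\frac32\ln\left(1+\frac{1}{\lambda\mu}\right).$$ Then for all $\lambda>1$ and all $n\ge1$, $$\Pr[\bar X_n\ge\lambda\mu]\ge\exp\left\{-n\cdot\left[H(\lambda,\mu)+\frac{\ln(2\pi n)}{2n}+\frac{\Delta_U(\lambda,\mu)}{n}\right]\right\}.$$ In addition, for all $\lambda\in(0,1)$ and all $n\ge\frac{1}{\lambda\mu}$, $$\Pr[\bar X_n\le\lambda\mu]\ge\exp\left\{-n\cdot\left[H(\lambda,\mu)+\frac{\ln(2\pi n)}{2n}+\frac{\Delta_L(\lambda,\mu)}{n}\right]\right\}.$$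
   Context: A geometric random variable (failure model) with parameter $p\in(0,1)$ satisfies $\Pr[X=k]=p(1-p)^k$ for $k=0,1,2,\dots$; its mean is $\mu=(1-p)/p$, i.e. $p=1/(1+\mu)$. $\ln$ is the natural logarithm. *)

(* Defs.v *)
From mathcomp Require Import all_boot all_order all_algebra.
From mathcomp Require Import all_classical all_reals all_analysis.
Import Order.TTheory GRing.Theory Num.Theory.
Import numFieldNormedType.Exports.

Set Implicit Arguments.
Unset Strict Implicit.
Unset Printing Implicit Defensive.

Local Open Scope classical_set_scope.
Local Open Scope ring_scope.

(* Failure model: the number of failures before the first success.  The masses
   sum to 1, so X is almost surely, but not necessarily everywhere, a natural
   number. *)
Definition geometric_rv (d : measure_display) (T : measurableType d)
    (R : realType) (P : probability T R) (X : {RV P >-> R}) (p : R) : Prop :=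
  0 < p < 1 /\
  forall k : nat, P [set w | X w = k%:R] = (p * (1 - p) ^+ k)%:E.

Definition mutually_independent (d : measure_display) (T : measurableType d)
    (R : realType) (P : probability T R) (n : nat)
    (X : 'I_n -> {RV P >-> R}) : Prop :=
  forall (J : {set 'I_n}) (A : 'I_n -> set R),
    (forall i, measurable (A i)) ->
    P [set w | forall i, i \in J -> A i (X i w)] =
    (\prod_(i in J) P (X i @^-1` A i))%E.

Definition sample_mean (d : measure_display) (T : measurableType d)
    (R : realType) (P : probability T R) (n : nat)
    (X : 'I_n -> {RV P >-> R}) (w : T) : R :=
  (\sum_(i < n) X i w) / n%:R.

Definition H_rate (R : realType) (lambda mu : R) : R :=
  mu * lambda * ln lambda
  - (1 + mu * lambda) * ln ((1 + mu * lambda) / (1 + mu)).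

Definition Delta_U (R : realType) (lambda mu : R) : R :=
  7 / 6 + ln (lambda + 2 / mu).

Definition Delta_L (R : realType) (lambda mu : R) : R :=
  1 / 6 + 3 / 2 * ln (1 + 1 / (lambda * mu)).

(* Main.v *)
Require Import Defs.
From mathcomp Require Import all_boot all_order all_algebra.
From mathcomp Require Import all_classical all_reals all_analysis.
From mathcomp Require Import measurable_realfun ring lra.
Import Order.TTheory GRing.Theory Num.Theory.
Import numFieldNormedType.Exports.

Local Open Scope classical_set_scope.
Local Open Scope ring_scope.

(** Write [k] for [n * lambda * mu] rounded to an integer, down for the lower
    tail and up (in fact to the next larger integer) for the upper tail, and
    [x = k / n].  The mean determines [p = 1 / (1 + mu)]
    ([geometric_rv_mean]).

    The proof compares both tails with
    [B = 'C(n + k, n) * p^n * (1 - p)^k], the probability of [n] successes in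
    [n + k] trials.  Counting the integer vectors of sum at most [k] gives
    [Pr (sum <= k) >= B] ([lower_tail_ge_bin]).  Counting those of sum [k], each
    shifted along one coordinate, gives
    [Pr (sum >= k) >= B / (2 * p * (1 + x))] ([upper_tail_ge_bin_half]).  The
    single mass at [k], which is [B / (1 + x)], would be too small a bound when
    [mu] is large.

    The binomial coefficient is estimated with the entropy form
    [sqrt ((n + k) / (8 n k)) * (n + k)^(n + k) / (n^n k^k)] ([ln_bin_ge]).
    The constant 8 is exact at [n = k = 1], and the ratio of the two sides only
    grows with [n] and [k], because the error term of Stirling's formula has
    decreasing decrements.  The statement asks for [2 pi exp (1 / 3)] in place
    of 8, so that [pi >= 3] suffices ([ln8_le_ln2pi]).

    Finally the exponent, which is the rate function at [x], is moved to
    [lambda * mu].  The rate is convex ([log_sum_ineq]), hence the change is at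
    most its derivative at [x], as [n] times the rounding error is at most 1.
    The resulting corrections are absorbed by [Delta_L] and [Delta_U]
    ([lower_tail_exponent], [upper_tail_exponent]). *)

(** * A lower bound for binomial coefficients *)
(** The first four terms of the binomial expansion; the terms dropped are
    nonnegative.  The cubic term is kept because the quadratic truncation falls
    short of the bound required in [ln_succ_ratio_scaled_anti] once [n > 1]. *)
Lemma expr1D_ge_cubic (R : realFieldType) (u : R) (m : nat) : 0 <= u ->
  1 + m%:R * u + m%:R * (m%:R - 1) / 2 * u ^+ 2
    + m%:R * (m%:R - 1) * (m%:R - 2) / 6 * u ^+ 3 <= (1 + u) ^+ m.
Proof.
move=> u0; elim: m => [|m IHm]; first by rewrite expr0; lra.
have u1 : 0 <= 1 + u by lra.
rewrite [(1 + u) ^+ _]exprSr; apply: (le_trans _ (ler_wpM2r u1 IHm)).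
have Q0 : 0 <= m%:R * (m%:R - 1) * (m%:R - 2) / 6 :> R.
  case: m {IHm} => [|[|m]]; [lra|lra|].
  rewrite -[m.+2]addn2 natrD; have := ler0n R m; set t := m%:R => t0.
  rewrite (_ : _ / 6 = (t + 2) * (t + 1) * t / 6); last ring.
  by rewrite divr_ge0 ?mulr_ge0 //; lra.
rewrite -subr_ge0 -natr1.
rewrite (_ : _ - _ = m%:R * (m%:R - 1) * (m%:R - 2) / 6 * u ^+ 4); last by field.
by rewrite mulr_ge0 // exprn_ge0.
Qed.

(** The decrements of the sequence [lnfact_defect] below decrease.  With
    [N = n + 1] and [u = 1 / (N^2 - 1)], exponentiating turns the inequality
    into [(N + 1) / (N - 1) <= (1 + u)^(2 N)], which follows from the cubic
    truncation of the right-hand side. *)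
Lemma ln_succ_ratio_scaled_anti (R : realType) (n : nat) : (0 < n)%N ->
  (n%:R + 3 / 2) * (ln n.+2%:R - ln n.+1%:R)
  <= (n%:R + 1 / 2) * (ln n.+1%:R - ln n%:R) :> R.
Proof.
move=> n0.
have n1 : 1 <= n%:R :> R by rewrite ler1n.
pose u : R := (n%:R * (n%:R + 2))^-1.
have u0 : 0 < u by rewrite invr_gt0 mulr_gt0 //; lra.
have pw : (n%:R + 2) / n%:R <= (1 + u) ^+ (2 * n.+1).
  apply: (le_trans _ (expr1D_ge_cubic _ _ (2 * n.+1) (ltW u0))).
  rewrite natrM -natr1 /u -subr_ge0; set t : R := n%:R in n1 *.
  rewrite (_ : _ - _ = (t^+3 + 3 * t^+2 + 8 * t) / (3 * t ^+ 3 * (t + 2) ^+ 3)).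
    by rewrite divr_ge0 // ?addr_ge0 ?mulr_ge0 ?exprn_ge0 //; lra.
  by field; apply/andP; split; lra.
have e1 : 1 + u = (n%:R + 1) ^+ 2 / (n%:R * (n%:R + 2)).
  by rewrite /u; field; apply/andP; split; lra.
have p0 : (n%:R : R) \in Num.pos by rewrite posrE; lra.
have p1 : (n%:R + 1 : R) \in Num.pos by rewrite posrE; lra.
have p2 : (n%:R + 2 : R) \in Num.pos by rewrite posrE; lra.
have : ln ((n%:R + 2) / n%:R) <= ln ((1 + u) ^+ (2 * n.+1)).
  by rewrite ler_ln ?posrE ?exprn_gt0 ?divr_gt0 //; lra.
rewrite lnXn; last lra.
rewrite e1 !ln_div ?posrE ?mulr_gt0 ?exprn_gt0 //; try lra.
rewrite lnXn; last lra.
rewrite lnM //.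
rewrite -[_ *+ (2 * _)]mulr_natl natrM -[n.+2]addn2 -[n.+1]addn1 !natrD -[_ *+ 2]mulr_natl.
lra.
Qed.

Section log_fact.
Context {R : realType}.

(** The error term of Stirling's formula, without the linear part [n]:
    [lnfact_defect n + n] decreases to [ln (2 pi) / 2].  Adding a linear term
    changes nothing in [lnfact_defectD], where it cancels. *)
Definition lnfact_defect (n : nat) : R := ln n`!%:R - (n%:R + 1 / 2) * ln n%:R.

Lemma lnfact_defectS (n : nat) : (0 < n)%N ->
  lnfact_defect n - lnfact_defect n.+1 = (n%:R + 1 / 2) * (ln n.+1%:R - ln n%:R).
Proof.
move=> n0; rewrite /lnfact_defect factS natrM lnM ?posrE ?ltr0n ?fact_gt0 //.
by set L := ln n.+1%:R; rewrite -natr1; ring.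
Qed.

Lemma lnfact_defect_drop_anti (m n : nat) : (0 < n)%N -> (n <= m)%N ->
  lnfact_defect m - lnfact_defect m.+1 <= lnfact_defect n - lnfact_defect n.+1.
Proof.
move=> n0; elim: m => [|m IHm]; first by rewrite leqn0 => /eqP nE; rewrite nE in n0.
rewrite leq_eqVlt => /predU1P[->//|]; rewrite ltnS => nm.
apply: (le_trans _ (IHm nm)); have m0 := leq_trans n0 nm.
rewrite !lnfact_defectS //; have := ln_succ_ratio_scaled_anti R m m0; set L1 := ln m.+1%:R; set L2 := ln m.+2%:R; rewrite -natr1; lra.
Qed.

(** Since the decrements decrease, replacing [n] by [n + 1] makes the left-hand
    difference grow: [lnfact_defect] loses less at [n + k] than at [n].  By
    symmetry the same holds in [k], so the minimum is attained at
    [n = k = 1], where it equals [- 3 / 2 * ln 2].  This replaces the limit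
    constant of Stirling's formula by an explicit value. *)
Lemma lnfact_defectD (n k : nat) : (0 < n)%N -> (0 < k)%N ->
  - (3 / 2) * ln 2 <= lnfact_defect (n + k) - lnfact_defect n - lnfact_defect k.
Proof.
elim: n => // n IHn _ k0.
have [->|n0] := posnP n.
  elim: k k0 {IHn} => // k IHk _.
  have [->|k0] := posnP k.
    by rewrite /lnfact_defect [X in X`!]/= (_ : 2`! = 2)%N // (_ : 1`! = 1)%N // ln1; lra.
  have := lnfact_defect_drop_anti (1 + k) k k0 (leq_addl _ _).
  by have := IHk k0; rewrite addnS; lra.
have := lnfact_defect_drop_anti (n + k) n n0 (leq_addr _ _).
by have := IHn n0 k0; rewrite addSn; lra.
Qed.

(** In multiplicative form,
    ['C(n + k, n) >= sqrt ((n + k) / (8 n k)) * (n + k)^(n + k) / (n^n k^k)].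
    Stirling's formula has [2 pi] in place of [8], with a correction
    [exp (- 1 / (12 n) - 1 / (12 k))]; [ln8_le_ln2pi] compares the two. *)
Lemma ln_bin_ge (n k : nat) : (0 < n)%N -> (0 < k)%N ->
  (n%:R + k%:R + 1 / 2) * ln (n%:R + k%:R) - (n%:R + 1 / 2) * ln n%:R
   - (k%:R + 1 / 2) * ln k%:R - (3 / 2) * ln 2 <= ln 'C(n + k, n)%:R :> R.
Proof.
move=> n0 k0.
have := @bin_fact (n + k) n (leq_addr _ _); rewrite addKn => /(congr1 (fun m => ln (m%:R : R))).
rewrite !natrM !lnM ?posrE ?mulr_gt0 ?ltr0n ?fact_gt0 ?bin_gt0 ?leq_addr //.
have := lnfact_defectD n k n0 k0; rewrite /lnfact_defect natrD; lra.
Qed.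


End log_fact.

(** * The numerical comparison of 8 and 2 pi *)
Section pi_bound.
Context {R : realType}.

Lemma sin_le_id (x : R) : 0 < x -> sin x <= x.
Proof.
move=> x0.
have [|z _] := @MVT R sin cos 0 x x0 (fun z _ => is_derive_sin z).
  by apply: continuous_subspaceT => z; exact: continuous_sin.
rewrite sin0 !subr0 => ->; rewrite -[leRHS]mul1r ler_wpM2r ?cos_le1 //; exact: ltW.
Qed.

(** [sin (pi / 6) = 1 / 2] and [sin x <= x].  The value of the sine comes from
    the triple angle formula at [pi / 2]: [s = sin (pi / 6)] is a root of
    [4 s^3 - 3 s + 1 = (s + 1) (2 s - 1)^2]. *)
Lemma pi_ge3 : 3 <= pi :> R.
Proof.
have pi0 := pi_gt0 R.
pose s : R := sin (pi / 6).
have s0 : 0 < s by apply: sin_gt0_pi; lra.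
have c2 : cos (pi / 6) ^+ 2 = 1 - s ^+ 2 by rewrite cos2sin2.
have : sin (pi / 6 *+ 2 + pi / 6) = 1 :> R.
  by rewrite -[RHS]sin_pihalf; congr sin; rewrite mulr2n; field.
rewrite sinD sin_mulr2n cos_mulr2n c2 -/s => e.
have {}e : (s + 1) * (2 * s - 1) ^+ 2 = 0.
  move: e; set c := cos _ in c2 * => e.
  have h : 2 * s * c ^+ 2 + ((1 - s ^+ 2) *+ 2 - 1) * s = 1 by rewrite -[RHS]e; ring.
  rewrite c2 in h.
  by rewrite -(subrr 1) -[X in _ = _ - X]h; ring.
have s1 : s = 1 / 2.
  move/eqP: e; rewrite mulf_eq0 sqrf_eq0 => /orP[] /eqP; lra.
have := sin_le_id (pi / 6); rewrite -/s s1; lra.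
Qed.

(** The term [1 / 3] is twice the constant [1 / 6] of [Delta_L]; it is what
    makes the bound of [ln_bin_ge] sufficient.  Since [pi >= 3] and
    [exp (1 / 3) >= 4 / 3], indeed [2 pi exp (1 / 3) >= 8]. *)
Lemma ln8_le_ln2pi : ln 8 <= ln (2 * pi) + 1 / 3 :> R.
Proof.
have pi3 := pi_ge3.
have e3 : 4 / 3 <= expR (1 / 3) :> R by apply: (le_trans _ (expR_ge1Dx _)); lra.
rewrite -[1 / 3]expRK -lnM ?posrE ?expR_gt0 //; last lra.
by rewrite ler_ln ?posrE ?mulr_gt0 ?expR_gt0 //; nra.
Qed.
End pi_bound.

(** * Independent geometric variables *)
Section prob.
Context {R : realType} {d : measure_display} {T : measurableType d} {P : probability T R}.

Lemma measurable_sample_mean (n : nat) (X : 'I_n -> {RV P >-> R}) :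
  measurable_fun setT (sample_mean X).
Proof.
rewrite /sample_mean; apply: measurable_funM => //.
by apply: measurable_sum => i; exact: measurable_funPT.
Qed.

(** The events that [X] takes the integer vector [f a] are pairwise disjoint
    and contained in [E], and by independence each has probability
    [p^n (1 - p)^(sum of f a)].  Tail bounds then follow by counting vectors. *)
Lemma probability_ge_sum_geometric (n : nat) (X : 'I_n -> {RV P >-> R}) (p : R)
    (I : finType) (A : {set I}) (f : I -> 'I_n -> nat) (E : set T) :
  mutually_independent X -> (forall j, geometric_rv (X j) p) ->
  {in A &, forall a b, f a =1 f b -> a = b} ->
  measurable E ->
  (forall a w, a \in A -> (forall j, X j w = (f a j)%:R) -> E w) ->
  ((\sum_(a in A) p ^+ n * (1 - p) ^+ (\sum_j f a j))%:E <= P E)%E.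
Proof.
move=> indep geom finj mE FE.
pose F a := [set w | forall j, j \in [set: 'I_n]%SET -> [set (f a j)%:R] (X j w)].
have PF a : P (F a) = (p ^+ n * (1 - p) ^+ (\sum_j f a j))%:E.
  rewrite /F (indep _ (fun j => [set (f a j)%:R])) //.
  transitivity (\prod_(j < n) (p * (1 - p) ^+ f a j)%:E)%E.
    apply: eq_big => [j|j _]; first by rewrite inE.
    by rewrite -(geom j).2.
  transitivity ((\prod_(j < n) (p * (1 - p) ^+ f a j))%:E).
    by rewrite (big_morph EFin (id1 := 1%E) (op1 := *%E)) //; move=> x y; rewrite EFinM.
  by rewrite big_split /= prodr_const card_ord prodrXr.
have mF a : measurable (F a).
  rewrite (_ : F a = \bigcap_(j in [set: 'I_n]) (X j @^-1` [set (f a j)%:R])).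
    exact: fin_bigcap_measurable.
  by apply/seteqP; split => w Fw j; [move=> _; apply: Fw; rewrite inE|move=> _; apply: Fw].
have tF : trivIset [set` A] F.
  move=> a b /= aA bA [w [Fa Fb]]; apply: finj => // j.
  by apply/eqP; rewrite -(eqr_nat R) -(Fa j (finset.in_setT j)) -(Fb j (finset.in_setT j)).
have -> : (\sum_(a in A) p ^+ n * (1 - p) ^+ (\sum_j f a j))%:E
    = P (\bigcup_(a in [set` enum A]) F a).
  rewrite measure_fin_bigcup //; last by move=> a b /= /[!mem_enum]; exact: tF.
  rewrite -fsbig_seq ?enum_uniq // -sumEFin big_enum /=.
  by apply: eq_bigr => a _; rewrite PF.
apply: le_measure; rewrite ?inE //.
  exact: fin_bigcup_measurable.
by move=> w [a /= /[!mem_enum] aA Fa]; apply: (FE a) => // j; apply: Fa; rewrite inE.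
Qed.

(** The variable is a natural number almost surely, so its mean is the limit of
    the partial sums of [k p (1 - p)^k].  These satisfy a recursion that avoids
    their closed form: as [k + 1] is [k] plus one,
    [s (m + 1) = (1 - p) (s m + g m)], where [g m] is the partial sum of the
    masses, which tends to 1.  In the limit [mu = (1 - p) (mu + 1)]. *)
Lemma geometric_rv_mean (X : {RV P >-> R}) (p mu : R) :
  geometric_rv X p -> 'E_P[X]%E = mu%:E -> mu * p = 1 - p.
Proof.
move=> [/andP[p0 p1] geom] EX.
pose F k := [set w | X w = k%:R].
have mF k : measurable (F k).
  by rewrite -[X in _.-measurable X]setTI; exact: (measurable_funPT X measurableT [set k%:R]).
have tF : trivIset setT F.
  by move=> i j _ _ [w []]; rewrite /F /= => -> /eqP; rewrite eqr_nat => /eqP.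
have mD : measurable (\bigcup_k F k) by exact: bigcupT_measurable.
have g1 : series (fun k => p * (1 - p) ^+ k) @ \oo --> (1 : R).
  have := @cvg_geometric_series R p (1 - p).
  rewrite subKr divff ?gt_eqF //; apply.
  by rewrite ger0_norm; lra.
have PD : P (\bigcup_k F k) = 1%E.
  rewrite measure_bigcup //.
  transitivity (limn (EFin \o series (fun k => p * (1 - p) ^+ k))).
    congr (limn _); apply/funext => m /=; rewrite /series /= -sumEFin.
    by apply: eq_big => [k|k _]; rewrite ?in_setT // -geom.
  by rewrite EFin_lim; [congr EFin; exact: cvg_lim|exact: cvgP g1].
have mX : measurable_fun setT (EFin \o X).
  by apply/measurable_EFinP; exact: measurable_funPT.
have ED : (\int[P]_(w in \bigcup_k F k) (X w)%:E)%E = mu%:E.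
  rewrite -EX expectation_def integral_mkcond; apply: ae_eq_integral => //.
    by apply: (measurable_restrictT _ mD).1; exact: measurable_funS mX.
  exists (~` \bigcup_k F k); split; first exact: measurableC.
    by have := @probability_setC _ _ _ P _ mD; rewrite PD subee.
  move=> w /= h Dw; apply: h => _; by rewrite patchE mem_set.
pose a k : R := k%:R * (p * (1 - p) ^+ k).
have a0 k : (0 <= (a k)%:E)%E.
  by rewrite lee_fin !mulr_ge0 ?exprn_ge0 //; lra.
have Ea : (\sum_(k <oo) (a k)%:E = mu%:E)%E.
  rewrite -ED ge0_integral_bigcup //; last 2 first.
  - exact: measurable_funTS.
  - by move=> w [k _ ->]; rewrite lee_fin.
  apply: eq_eseriesr => k _.
  transitivity (\int[P]_(w in F k) cst (k%:R : R)%:E w)%E.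
    rewrite integral_cst //.
    exact: (congr1 (fun z => (k%:R)%:E * z)%E (esym (geom k))).
  by apply: eq_integral => w /set_mem ->.
(* convergence of the real partial sums is read off from that of the extended
   real ones, the limit being finite by hypothesis *)
have sa : series a @ \oo --> mu.
  have : (fun m => \sum_(0 <= k < m) (a k)%:E)%E @ \oo --> mu%:E.
    by rewrite -Ea; apply: is_cvg_nneseries.
  move/fine_cvg; apply: cvg_trans; apply: near_eq_cvg; near=> m.
  by rewrite /= sumEFin.
have step m : series a m.+1 = (1 - p) * (series a m + series (fun k => p * (1 - p) ^+ k) m).
  rewrite /series /= big_nat_recl // /a mul0r add0r -big_split mulr_sumr.
  by apply: eq_bigr => k _; rewrite exprS -natr1 /=; ring.
have : series a @ \oo --> (1 - p) * (mu + 1).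
  rewrite -cvg_shiftS; under eq_fun do rewrite step.
  by apply: cvgM; [exact: cvg_cst|exact: cvgD].
move=> /(cvg_unique _ sa) => h; have := h (@Rhausdorff R); lra.
Unshelve. all: end_near.
Qed.
End prob.

(** * Tails of the sum *)
Section counting.
Context {R : realType} {d : measure_display} {T : measurableType d} {P : probability T R}.

(** There are ['C(n + k, n)] vectors of naturals with sum at most [k], and each
    has probability at least [p^n (1 - p)^k].  Keeping all these vectors rather
    than those of sum exactly [k] gains the factor [1 + k / n], which is
    needed when [k] is much larger than [n]. *)
Lemma lower_tail_ge_bin (n k : nat) (X : 'I_n -> {RV P >-> R}) (p : R) (E : set T) :
  mutually_independent X -> 0 < p < 1 -> (forall j, geometric_rv (X j) p) ->
  measurable E ->
  (forall w (m : nat), \sum_j X j w = m%:R -> (m <= k)%N -> E w) ->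
  (('C(n + k, n)%:R * p ^+ n * (1 - p) ^+ k)%:E <= P E)%E.
Proof.
move=> indep /andP[p0 p1] geom mE kE.
pose A := [set t : n.-tuple 'I_k.+1 | (\sum_(i <- t) i <= k)%N]%SET.
pose f (t : n.-tuple 'I_k.+1) (j : 'I_n) : nat := tnth t j.
have fsum t : (\sum_j f t j = \sum_(i <- t) i)%N by rewrite big_tuple.
apply: le_trans (probability_ge_sum_geometric _ _ p _ A f E indep geom _ mE _); last 2 first.
- move=> a b _ _ ab; apply: eq_from_tnth => j; apply: val_inj; exact: ab.
- move=> a w; rewrite inE -fsum => ak Xa; apply: kE ak.
  by rewrite natr_sum; apply: eq_bigr => j _; exact: Xa.
rewrite lee_fin -mulrA -card_partial_ord_partitions mulr_natl -sumr_const.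
apply: ler_sum => t; rewrite inE -fsum => tk.
apply: ler_wpM2l; first by rewrite exprn_ge0 // ltW.
by apply: ler_wiXn2l => //; lra.
Qed.

(** Vectors of sum [k + m] with [m < M] are obtained by adding [m] to the first
    coordinate of a vector of sum [k].  These are only some of the vectors of
    sum [k + m], but this subfamily already has total mass
    ['C(n + k, n) p^n (1 - p)^k (1 - (1 - p)^M)], a factor almost [1 / p] above
    the mass at [k] alone. *)
Lemma upper_tail_ge_bin (n k M : nat) (X : 'I_n.+1 -> {RV P >-> R}) (p : R) (E : set T) :
  mutually_independent X -> 0 < p < 1 -> (forall j, geometric_rv (X j) p) ->
  measurable E ->
  (forall w (m : nat), \sum_j X j w = m%:R -> (k <= m)%N -> E w) ->
  (('C(n + k, n)%:R * p ^+ n * (1 - p) ^+ k * (1 - (1 - p) ^+ M))%:E <= P E)%E.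
Proof.
move=> indep /andP[p0 p1] geom mE kE.
pose A := [set u : n.+1.-tuple 'I_k.+1 * 'I_M | (\sum_(i <- u.1) i == k)%N]%SET.
pose f (u : n.+1.-tuple 'I_k.+1 * 'I_M) (j : 'I_n.+1) : nat :=
  (tnth u.1 j + (j == ord0) * u.2)%N.
have fsum u : (\sum_j f u j = \sum_(i <- u.1) i + u.2)%N.
  rewrite big_tuple big_split /=; congr addn.
  rewrite (bigD1 ord0) //= mul1n big1 ?addn0 // => j /negbTE ->; exact: mul0n.
apply: le_trans (probability_ge_sum_geometric _ _ p _ A f E indep geom _ mE _); last 2 first.
- move=> [t a] [s b]; rewrite !inE /= => /eqP ta /eqP sb ab.
  have eab : a = b :> nat.
    have : (\sum_j f (t, a) j = \sum_j f (s, b) j)%N by apply: eq_bigr => j _; exact: ab.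
    by rewrite !fsum /= ta sb => /addnI.
  congr pair; last exact: val_inj.
  apply: eq_from_tnth => j; apply: val_inj; have := ab j.
  by rewrite /f /= eab => /addIn.
- move=> u w; rewrite inE => /eqP uk Xu; apply: (kE w (\sum_j f u j)%N).
    by rewrite natr_sum; apply: eq_bigr => j _; exact: Xu.
  by rewrite fsum uk leq_addr.
rewrite lee_fin.
have -> : \sum_(u in A) p ^+ n.+1 * (1 - p) ^+ (\sum_j f u j)
    = \sum_(t | (\sum_(i <- (t : n.+1.-tuple 'I_k.+1)) i == k)%N)
        \sum_(m < M) p ^+ n.+1 * (1 - p) ^+ (k + m).
  rewrite pair_big /=; apply: eq_big => [u|u]; first by rewrite inE andbT.
  by rewrite inE fsum => /eqP ->.
rewrite sumr_const -mulr_sumr.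
under eq_bigr do rewrite exprD.
rewrite -mulr_sumr -cardsE card_ord_partitions -mulr_natl.
have -> : 1 - (1 - p) ^+ M = p * \sum_(m < M) (1 - p) ^+ m.
  by rewrite -opprB subrX1 addrAC subrr add0r mulNr opprK.
by rewrite exprS le_eqVlt; apply/orP; left; apply/eqP; ring.
Qed.

(** The same bound for [M] so large that [(1 - p)^M <= 1 / 2], written with the
    binomial coefficient of [ln_bin_ge].  Giving up a factor 2 avoids the limit
    in [M]; [Delta_U] has room for a factor [expR 1]. *)
Lemma upper_tail_ge_bin_half (n k : nat) (X : 'I_n -> {RV P >-> R}) (p : R) (E : set T) :
  (0 < n)%N ->
  mutually_independent X -> 0 < p < 1 -> (forall j, geometric_rv (X j) p) ->
  measurable E ->
  (forall w (m : nat), \sum_j X j w = m%:R -> (k <= m)%N -> E w) ->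
  (('C(n + k, n)%:R * p ^+ n * (1 - p) ^+ k / ((1 + k%:R / n%:R) * p * 2))%:E <= P E)%E.
Proof.
case: n X => // n X _ indep p01 geom mE kE; case/andP: (p01) => p0 p1.
have [M qM] : exists M, (1 - p) ^+ M <= 1 / 2.
  have q1 : `|1 - p| < 1 by rewrite gtr0_norm; lra.
  have [M _ hM] : \forall M \near \oo, (1 - p) ^+ M < 1 / 2.
    by apply: (cvgr_lt 0 (cvg_expr q1)); lra.
  by exists M; apply/ltW/hM => /=.
apply: le_trans (upper_tail_ge_bin n k M X p E indep p01 geom mE kE).
have N0 : 0 < n.+1%:R :> R by rewrite ltr0n.
have K0 : 0 <= k%:R :> R by rewrite ler0n.
have Cn : 'C(n.+1 + k, n.+1)%:R = 'C(n + k, n)%:R * (1 + k%:R / n.+1%:R) :> R.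
  apply: (mulIf (x := n.+1%:R)); first by rewrite gt_eqF.
  rewrite -mulrA mulrDl mul1r divfK ?gt_eqF // -!natrD -!natrM mulnC.
  by rewrite addSn -mul_bin_diag mulnC.
rewrite lee_fin Cn exprS.
have -> : 'C(n + k, n)%:R * (1 + k%:R / n.+1%:R) * (p * p ^+ n) * (1 - p) ^+ k
    / ((1 + k%:R / n.+1%:R) * p * 2)
    = 'C(n + k, n)%:R * p ^+ n * (1 - p) ^+ k * (1 / 2).
  by field; repeat (apply/andP; split); lra.
apply: ler_wpM2l; last lra.
by rewrite !mulr_ge0 ?exprn_ge0 //; lra.
Qed.
End counting.

(** * The rate function *)
Section analytic.
Context {R : realType}.

Lemma ln_le_subr1 (x : R) : 0 < x -> ln x <= x - 1.
Proof. by move=> x0; have := @le_ln1Dx R (x - 1); rewrite addrCA subrr addr0; apply; lra. Qed.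

(** Concavity of [ln]: [(1 + x) / (1 + y)] is the mean of [x / y] and [1] with
    weights proportional to [y] and [1].  With [m] that mean, add [y] times
    [ln (x / y / m) <= x / y / m - 1] to [ln (1 / m) <= 1 / m - 1]; the two
    right-hand sides cancel. *)
Lemma log_sum_ineq (x y : R) : 0 < x -> 0 < y ->
  (1 + y) * (ln (1 + y) - ln (1 + x)) <= y * (ln y - ln x).
Proof.
move=> x0 y0.
have [m mE] : exists m, m = (1 + x) / (1 + y) by exists ((1 + x) / (1 + y)).
have m0 : 0 < m by rewrite mE divr_gt0; lra.
have h1 : ln (x / y / m) <= x / y / m - 1 by apply: ln_le_subr1; rewrite divr_gt0 // divr_gt0.
have h2 : ln m^-1 <= m^-1 - 1 by apply: ln_le_subr1; rewrite invr_gt0.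
have := ler_wpM2l (ltW y0) h1; move: h2.
have lnm : ln m = ln (1 + x) - ln (1 + y) by rewrite mE ln_div ?posrE //; lra.
rewrite !ln_div ?posrE ?divr_gt0 // lnV ?posrE // lnm => h2 h1'.
have : y * (x / y / m - 1) + (m^-1 - 1) = 0.
  by rewrite mE; field; apply/andP; split; lra.
lra.
Qed.

(** [H_rate lambda mu], as a function of [lambda * mu], lies above its tangent
    at [x]. *)
Lemma H_rate_ge (lambda mu x : R) : 0 < lambda -> 0 < mu -> 0 < x ->
  lambda * mu * (ln x - ln mu) - (1 + lambda * mu) * (ln (1 + x) - ln (1 + mu))
  <= H_rate lambda mu.
Proof.
move=> l0 m0 x0; have lm0 : 0 < lambda * mu by rewrite mulr_gt0.
have := log_sum_ineq x (lambda * mu) x0 lm0.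
rewrite /H_rate (mulrC mu lambda) lnM ?posrE // => h.
rewrite [X in _ <= _ - _ * X]ln_div ?posrE; lra.
Qed.

(** The exact exponent at [k] is [n] times the rate at [x = k / n], not at
    [lambda * mu].  The tangent at [x] bounds the difference by the derivative
    [ln x - ln mu - ln (1 + x) + ln (1 + mu)] of the rate at [x], times the
    rounding error [k - n * lambda * mu]. *)
Lemma ln_point_mass_ge (n k : nat) (lambda mu x : R) :
  (0 < n)%N -> (0 < k)%N -> 0 < lambda -> 0 < mu -> x = k%:R / n%:R ->
  - (n%:R * H_rate lambda mu)
  - (k%:R - n%:R * (lambda * mu)) * (ln x - ln mu - ln (1 + x) + ln (1 + mu))
  + (ln (1 + x) - ln x - ln n%:R) / 2 - 3 / 2 * ln 2
  <= ln 'C(n + k, n)%:R - n%:R * ln (1 + mu) + k%:R * (ln mu - ln (1 + mu)).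
Proof.
move=> n0 k0 l0 m0 xE.
have N0 : 0 < n%:R :> R by rewrite ltr0n.
have K0 : 0 < k%:R :> R by rewrite ltr0n.
have x0 : 0 < x by rewrite xE divr_gt0.
have lx : ln x = ln k%:R - ln n%:R by rewrite xE ln_div ?posrE.
have l1x : ln (1 + x) = ln (n%:R + k%:R) - ln n%:R.
  rewrite -ln_div ?posrE ?addr_gt0 //; congr ln.
  by rewrite xE; field; lra.
have := @ln_bin_ge R n k n0 k0; have := ler_wpM2l (ltW N0) (H_rate_ge lambda mu x l0 m0 x0).
rewrite lx l1x; lra.
Qed.

(** Here [x <= lambda * mu <= mu], the derivative of the rate at [x] lies
    between [ln (x / (1 + x))] and 0, and the rounding error between [-1] and 0.
    So rounding costs at most [ln ((1 + x) / x)], of which the prefactor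
    [sqrt ((1 + x) / x)] recovers half.  The other half is at most
    [3 / 2 * ln (1 + 1 / (lambda * mu))] because [lambda * mu <= 2 * x], which
    is where [k > 0] enters. *)
Lemma lower_tail_exponent (n k : nat) (lambda mu : R) :
  (0 < n)%N -> (0 < k)%N -> 0 < lambda <= 1 -> 0 < mu ->
  k%:R <= n%:R * (lambda * mu) <= k.+1%:R ->
  - (n%:R * (H_rate lambda mu + ln (2 * pi * n%:R) / (2 * n%:R)
             + Delta_L lambda mu / n%:R))
  <= ln 'C(n + k, n)%:R - n%:R * ln (1 + mu) + k%:R * (ln mu - ln (1 + mu)).
Proof.
move=> n0 k0 /andP[l0 l1] m0 /andP[ky yk].
have N0 : 0 < n%:R :> R by rewrite ltr0n.
have K1 : 1 <= k%:R :> R by rewrite ler1n.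
have [x xE] : exists x : R, x = k%:R / n%:R by eexists.
have [y yE] : exists y, y = lambda * mu by eexists.
have nx : n%:R * x = k%:R by rewrite xE mulrC divfK // gt_eqF.
have x0 : 0 < x by rewrite xE divr_gt0 //; lra.
have y0 : 0 < y by rewrite yE mulr_gt0.
rewrite -natr1 in yk.
have xy : x <= y by rewrite -(ler_pM2l N0) nx yE.
have yx : y <= 2 * x by rewrite -(ler_pM2l N0) mulrCA nx yE; lra.
have ymu : y <= mu by rewrite yE ler_piMl // ltW.
have bra : ln x - ln mu - ln (1 + x) + ln (1 + mu) <= 0.
  have : ln (x * (1 + mu)) <= ln (mu * (1 + x)).
    by rewrite ler_ln ?posrE ?mulr_gt0 //; nra.
  by rewrite !lnM ?posrE //; lra.
have lmu : ln mu <= ln (1 + mu) by rewrite ler_ln ?posrE; lra.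
have lxy : ln (1 + x) - ln x <= 3 * ln (1 + 1 / y).
  rewrite mulr_natl -lnXn; last by rewrite addr_gt0 ?divr_gt0.
  rewrite -ln_div ?posrE; try lra.
  rewrite ler_ln ?posrE ?exprn_gt0 ?addr_gt0 ?divr_gt0 //; try lra.
  rewrite -subr_ge0.
  have -> : (1 + 1 / y) ^+ 3 - (1 + x) / x
      = (x * (1 + y) ^+ 3 - (1 + x) * y ^+ 3) / (x * y ^+ 3).
    by field; apply/andP; split; lra.
  apply: divr_ge0; last by rewrite mulr_ge0 ?exprn_ge0 //; lra.
  nra.
have L8 := ln8_le_ln2pi (R := R).
have l8 : ln 8 = 3 * ln 2 :> R.
  by rewrite (_ : 8 = 2 ^+ 3); [rewrite lnXn // mulr_natl|ring].
have := ln_point_mass_ge n k lambda mu x n0 k0 l0 m0 xE.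
rewrite /Delta_L -yE (lnM (x := 2 * pi)) ?posrE ?mulr_gt0 ?pi_gt0 //.
have -> : n%:R * (H_rate lambda mu + (ln (2 * pi) + ln n%:R) / (2 * n%:R)
    + (1 / 6 + 3 / 2 * ln (1 + 1 / y)) / n%:R)
    = n%:R * H_rate lambda mu + (ln (2 * pi) + ln n%:R) / 2
      + (1 / 6 + 3 / 2 * ln (1 + 1 / y)) by field; lra.
rewrite -yE in ky yk *.
have : 0 <= (1 + (k%:R - n%:R * y)) * - (ln x - ln mu - ln (1 + x) + ln (1 + mu)).
  by rewrite mulr_ge0; lra.
lra.
Qed.

(** Here [mu <= lambda * mu <= x <= lambda * mu + 1], and rounding up costs at
    most the derivative of the rate at [x].  The terms in [ln (1 + mu)] then
    cancel, owing to the factor [1 / p = 1 + mu] of the upper tail, and what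
    remains is compared using [ln x <= ln (lambda * mu + 2)] and [ln 2 <= 1]. *)
Lemma upper_tail_exponent (n k : nat) (lambda mu : R) :
  (0 < n)%N -> (0 < k)%N -> 1 <= lambda -> 0 < mu ->
  n%:R * (lambda * mu) <= k%:R <= n%:R * (lambda * mu) + 1 ->
  - (n%:R * (H_rate lambda mu + ln (2 * pi * n%:R) / (2 * n%:R)
             + Delta_U lambda mu / n%:R))
  <= ln 'C(n + k, n)%:R - n%:R * ln (1 + mu) + k%:R * (ln mu - ln (1 + mu))
     - ln (1 + k%:R / n%:R) + ln (1 + mu) - ln 2.
Proof.
move=> n0 k0 l1 m0 /andP[yk ky].
have N1 : 1 <= n%:R :> R by rewrite ler1n.
have K1 : 1 <= k%:R :> R by rewrite ler1n.
have N0 : 0 < n%:R :> R by lra.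
have l0 : 0 < lambda by lra.
have [x xE] : exists x : R, x = k%:R / n%:R by eexists.
have [y yE] : exists y, y = lambda * mu by eexists.
have nx : n%:R * x = k%:R by rewrite xE mulrC divfK // gt_eqF.
have x0 : 0 < x by rewrite xE divr_gt0 //; lra.
have y0 : 0 < y by rewrite yE mulr_gt0.
rewrite -yE in ky yk.
have yx : y <= x by rewrite -(ler_pM2l N0) nx.
have xy : x <= y + 1 by rewrite -(ler_pM2l N0) nx; nra.
have ymu : mu <= y by rewrite yE ler_peMl // ltW.
have bra : 0 <= ln x - ln mu - ln (1 + x) + ln (1 + mu).
  have : ln (mu * (1 + x)) <= ln (x * (1 + mu)).
    by rewrite ler_ln ?posrE ?mulr_gt0 //; nra.
  by rewrite !lnM ?posrE //; lra.
have lxx : ln x <= ln (1 + x) by rewrite ler_ln ?posrE; lra.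
have lxy : ln x <= ln (y + 2) by rewrite ler_ln ?posrE; lra.
have l2 : ln 2 <= 1 :> R by have := @ln_le_subr1 2; lra.
have lD : ln (lambda + 2 / mu) = ln (y + 2) - ln mu.
  rewrite -ln_div ?posrE //; last lra.
  by congr ln; rewrite yE; field; lra.
have L8 := ln8_le_ln2pi (R := R).
have l8 : ln 8 = 3 * ln 2 :> R.
  by rewrite (_ : 8 = 2 ^+ 3); [rewrite lnXn // mulr_natl|ring].
have := ln_point_mass_ge n k lambda mu x n0 k0 l0 m0 xE.
rewrite /Delta_U -yE lD (lnM (x := 2 * pi)) ?posrE ?mulr_gt0 ?pi_gt0 // -xE.
have -> : n%:R * (H_rate lambda mu + (ln (2 * pi) + ln n%:R) / (2 * n%:R)
    + (7 / 6 + (ln (y + 2) - ln mu)) / n%:R)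
    = n%:R * H_rate lambda mu + (ln (2 * pi) + ln n%:R) / 2
      + (7 / 6 + (ln (y + 2) - ln mu)) by field; lra.
have : 0 <= (1 - (k%:R - n%:R * y)) * (ln x - ln mu - ln (1 + x) + ln (1 + mu)).
  by rewrite mulr_ge0; lra.
lra.
Qed.

Lemma ln_mulXX (c a b : R) (n k : nat) : 0 < c -> 0 < a -> 0 < b ->
  ln (c * a ^+ n * b ^+ k) = ln c + n%:R * ln a + k%:R * ln b.
Proof.
move=> c0 a0 b0; rewrite (lnM (y := b ^+ k)) ?posrE ?mulr_gt0 ?exprn_gt0 //.
rewrite (lnM (x := c)) ?posrE ?exprn_gt0 //.
by rewrite !lnXn // !mulr_natl.
Qed.
End analytic.

(** * The tail bounds *)
Theorem theorem2 (R : realType) (d : measure_display) (T : measurableType d)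
    (P : probability T R) (mu : R) (mu_gt0 : 0 < mu)
    (n : nat) (n_ge1 : (1 <= n)%N)
    (X : 'I_n -> {RV P >-> R})
    (X_indep : mutually_independent X)
    (p : R) (X_geom : forall i, geometric_rv (X i) p)
    (X_mean : forall i, 'E_P[X i]%E = mu%:E) :
  (forall lambda : R, 1 < lambda ->
     ((expR (- (n%:R * (H_rate lambda mu + ln (2 * pi * n%:R) / (2 * n%:R)
                        + Delta_U lambda mu / n%:R))))%:E
      <= P [set w | (lambda * mu <= sample_mean X w)%R])%E)
  /\
  (forall lambda : R, 0 < lambda < 1 -> 1 / (lambda * mu) <= n%:R ->
     ((expR (- (n%:R * (H_rate lambda mu + ln (2 * pi * n%:R) / (2 * n%:R)
                        + Delta_L lambda mu / n%:R))))%:E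
      <= P [set w | (sample_mean X w <= lambda * mu)%R])%E).
Proof.
have n0 : (0 < n)%N by [].
have N0 : 0 < n%:R :> R by rewrite ltr0n.
have i0 : 'I_n by exact: Ordinal n0.
have p01 : 0 < p < 1 := (X_geom i0).1.
have mup := geometric_rv_mean (X i0) p mu (X_geom i0) (X_mean i0).
have pE : p = (1 + mu)^-1.
  apply: (mulIf (x := 1 + mu)); first by rewrite gt_eqF //; lra.
  by rewrite mulVf ?gt_eqF //; lra.
have qE : 1 - p = mu / (1 + mu) by rewrite -mup pE.
have lnp : ln p = - ln (1 + mu) by rewrite pE lnV ?posrE //; lra.
have lnq : ln (1 - p) = ln mu - ln (1 + mu) by rewrite qE ln_div ?posrE //; lra.
case/andP: (p01) => p0 p1.
have q0 : 0 < 1 - p by lra.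
have mS : measurable_fun setT (sample_mean X) := measurable_sample_mean n X.
split.
- move=> lambda l1; have l0 : 0 < lambda by lra.
  have ny0 : 0 <= n%:R * (lambda * mu) by rewrite !mulr_ge0 //; lra.
  pose k := (Num.truncn (n%:R * (lambda * mu))).+1.
  have /andP[ky yk] : k.-1%:R <= n%:R * (lambda * mu) < k%:R by exact: truncn_itv.
  apply: le_trans (upper_tail_ge_bin_half n k X p _ n0 X_indep p01 X_geom _ _); last 2 first.
  - rewrite -[X in measurable X]setTI.
    exact: (measurable_fun_ler (measurable_cst (lambda * mu)) mS).
  - move=> w m Sm mk; rewrite /= /sample_mean Sm ler_pdivlMr // mulrC.
    by apply: le_trans (ltW yk) _; rewrite ler_nat.
  rewrite lee_fin.
  have C0 : 0 < 'C(n + k, n)%:R :> R by rewrite ltr0n bin_gt0 leq_addr.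
  have x0 : 0 < 1 + k%:R / n%:R :> R by rewrite addr_gt0 ?divr_gt0 ?ltr0n.
  have D0 : 0 < (1 + k%:R / n%:R) * p * 2 by rewrite !mulr_gt0.
  have B0 : 0 < 'C(n + k, n)%:R * p ^+ n * (1 - p) ^+ k by rewrite !mulr_gt0 ?exprn_gt0.
  rewrite -[leRHS]lnK ?posrE ?divr_gt0 // ler_expR ln_div ?posrE //.
  rewrite ln_mulXX // (lnM (y := 2)) ?posrE ?mulr_gt0 // (lnM (y := p)) ?posrE //.
  rewrite lnp lnq mulrN.
  apply: le_trans (upper_tail_exponent n k lambda mu n0 _ (ltW l1) mu_gt0 _) _ => //; last lra.
  by rewrite ltW //= -natr1 lerD2r.
move=> lambda /andP[l0 l1] nl.
have y0 : 0 < lambda * mu by rewrite mulr_gt0.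
have ny1 : 1 <= n%:R * (lambda * mu) by rewrite -ler_pdivrMr.
pose k := Num.truncn (n%:R * (lambda * mu)).
have /andP[ky yk] : k%:R <= n%:R * (lambda * mu) < k.+1%:R by apply: truncn_itv; lra.
have k0 : (0 < k)%N.
  by rewrite lt0n; apply/eqP => k0; move: yk; rewrite k0; lra.
apply: le_trans (lower_tail_ge_bin n k X p _ X_indep p01 X_geom _ _); last 2 first.
- rewrite -[X in measurable X]setTI.
  exact: (measurable_fun_ler mS (measurable_cst (lambda * mu))).
- move=> w m Sm mk; rewrite /= /sample_mean Sm ler_pdivrMr // mulrC.
  by apply: le_trans ky; rewrite ler_nat.
rewrite lee_fin.
have C0 : 0 < 'C(n + k, n)%:R :> R by rewrite ltr0n bin_gt0 leq_addr.
have B0 : 0 < 'C(n + k, n)%:R * p ^+ n * (1 - p) ^+ k by rewrite !mulr_gt0 ?exprn_gt0.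
rewrite -[leRHS]lnK ?posrE // ler_expR ln_mulXX // lnp lnq mulrN.
apply: lower_tail_exponent => //; first by rewrite l0 ltW.
by rewrite ky ltW.
Qed.
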